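(* Let $X$ be a connected CW complex. For each integer $m\ge2$, $$\mathrm{dcat}_1(X^{m-1})\le\mathrm{dTC}^{\mathcal D}_m(X)\le\mathrm{dcat}_1(X^m).$$
   Context: All spaces are connected CW complexes and maps are continuous. For a space $Z$ and an integer $n\ge 1$, let $\mathcal B_n(Z)$ be the set of probability measures on $Z$ supported on at most $n$ points, i.e. formal sums $\sum_{i=1}^n a_i z_i$ with $z_i\in Z$, $a_i\ge 0$, $\sum a_i=1$ (a point $z$ standing for the Dirac measure $\delta_z$). It carries the topology of weak convergence of measures; for metric $Z$ this is the topology of the Lévy–Prokhorov metric. For a map $f\colon E\to B$ put $E_n=\{\mu\in\mathcal B_n(E)\mid \mathrm{supp}(\mu)\subset f^{-1}(b)\text{ for some } b\in B\}$, a subspace of $\mathcal B_n(E)$, and let $f_n\colon E_n\to B$ send $\mu$ to that $b$. If $f$ is a fibration, then so is $f_n$. The distributional sectional category $\mathrm{dsecat}(f)$ of a fibration $f$ is the least integer $n\ge0$ such that $f_{n+1}$ has a section ($\infty$ if none exists). The distributional one-category is $\mathrm{dcat}_1(X)=\mathrm{dsecat}(q^X)$, where $q^X\colon\widetilde X\to X$ is the universal covering. Let $\pi=\pi_1(X)$. For $m\ge2$, $\widetilde X^m_\pi$ denotes the orbit space of $\widetilde X^m$ under the diagonal action of $\pi$, and $r^X_m\colon\widetilde X^m_\pi\to X^m$ is the induced covering map (corresponding to the diagonal subgroup of $\pi^m$). The $m$-th sequential diagonal distributional complexity is $\mathrm{dTC}^{\mathcal D}_m(X)=\mathrm{dsecat}(r^X_m)$.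 *)

(* Defs.v *)
From HB Require Import structures.
From mathcomp Require Import all_boot all_order all_algebra generic_quotient.
From mathcomp Require Import all_classical all_reals all_analysis.

Set Implicit Arguments.
Unset Strict Implicit.
Unset Printing Implicit Defensive.

Import Order.TTheory GRing.Theory Num.Theory.
Import numFieldNormedType.Exports.

Local Open Scope classical_set_scope.
Local Open Scope ring_scope.
Local Open Scope quotient_scope.

(* Nonempty spaces are modelled by [ptopologicalType]; the distinguished point
   is arbitrary, and maps are not required to preserve it. *)

(* J.H.C. Whitehead's definition through characteristic maps. The norm of
   'rV[R]_n is the sup norm, so the model n-cell is the cube [-1, 1]^n, which
   is homeomorphic to the Euclidean n-disc by a homeomorphism preserving
   boundaries; for n = 0 it is one point with empty boundary. *)
Definition CW_complex (R : realType) (X : topologicalType) : Prop :=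
  hausdorff_space X /\
  exists (I : Type) (dim : I -> nat) (Phi : forall i, 'rV[R]_(dim i) -> X),
    let cell i := Phi i @` [set x | `|x| < 1] in
    [/\ forall i, {within [set x | `|x| <= 1], continuous (Phi i)},
        forall i, set_inj [set x | `|x| < 1] (Phi i),
        trivIset setT cell /\ \bigcup_i cell i = setT,
        (forall i, exists J : set I,
           [/\ finite_set J, (forall j, J j -> (dim j < dim i)%N) &
               Phi i @` [set x | `|x| = 1] `<=` \bigcup_(j in J) cell j]) &
        forall A : set X, closed A <->
          forall i, closed ([set x | `|x| <= 1] `&` Phi i @^-1` A)].

Definition restricts_to_homeo (E B : topologicalType) (p : E -> B)
    (V : set E) (U : set B) : Prop :=
  exists s : B -> E,
    [/\ {within V, continuous p}, {within U, continuous s},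
        (forall v, V v -> U (p v) /\ s (p v) = v) &
        (forall u, U u -> V (s u) /\ p (s u) = u)].

Definition covering_map (E B : topologicalType) (p : E -> B) : Prop :=
  continuous p /\
  forall b, exists (U : set B) (S : set (set E)),
    [/\ open U /\ U b, (forall V, S V -> open V), trivIset S id,
        p @^-1` U = \bigcup_(V in S) V &
        forall V, S V -> restricts_to_homeo p V U].

Definition path_connected (R : realType) (Z : topologicalType) : Prop :=
  forall x y : Z, exists f : R -> Z,
    [/\ {within `[0, 1], continuous f}, f 0 = x & f 1 = y].

Definition simply_connected (R : realType) (Z : topologicalType) : Prop :=
  path_connected R Z /\
  forall f : R -> Z, {within `[0, 1], continuous f} -> f 0 = f 1 ->
    exists H : R * R -> Z,
      {within `[0, 1] `*` `[0, 1], continuous H} /\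
      forall t : R, t \in `[0, 1] ->
        [/\ H (0, t) = f t, H (1, t) = f 0, H (t, 0) = f 0 & H (t, 1) = f 0].

(* Over a connected, locally path connected base any two such coverings are
   isomorphic. *)
Record universal_covering (R : realType) (X : ptopologicalType) :=
  UniversalCovering {
    total_space : ptopologicalType;
    projection :> total_space -> X;
    projection_covering : covering_map projection;
    total_space_simply_connected : simply_connected R total_space
  }.

Definition borel (Z : ptopologicalType) := g_sigma_algebraType (@open Z).

Section weak_convergence.
Variables (R : realType) (Z : ptopologicalType).

Definition bounded_continuous : set (Z -> R) :=
  [set g | continuous g /\ exists M : R, forall z, `|g z| <= M].

Definition integrate (mu : probability (borel Z) R) :
    {ptws bounded_continuous -> R} :=
  fun g => \int[mu]_z (set_val g : Z -> R) z.

(* The coarsest topology making [mu |-> \int g dmu] continuous for every bounded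
   continuous [g]. *)
Definition measures : Type := initial_topology integrate.
HB.instance Definition _ := Topological.on measures.

(* The equation below is between functions on all subsets of [Z], not only the
   Borel ones: a [probability] has unspecified values on nonmeasurable sets, and
   this singles out one representative of each finitely supported measure. *)
Definition finitely_supported (n : nat) : set measures :=
  [set mu | exists (a : 'I_n -> R) (z : 'I_n -> borel Z),
    [/\ forall i, 0 <= a i, \sum_(i < n) a i = 1 &
        forall A : set (borel Z),
          (mu : probability (borel Z) R) A =
            (\sum_(i < n) (a i)%:E * \d_(z i) A)%E]].

Definition msupport (mu : measures) : set Z :=
  [set z | forall U : set Z, open U -> U z ->
    (0 < (mu : probability (borel Z) R) U)%E].

End weak_convergence.

Section dsecat.
Variables (R : realType) (E B : ptopologicalType) (f : E -> B).

Definition fibre_measures (n : nat) : set (measures R E) :=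
  [set mu | finitely_supported n mu /\
            exists b, msupport mu `<=` f @^-1` [set b]].

Definition fibre_map (n : nat) (mu : fibre_measures n) : B :=
  get [set b | msupport (set_val mu) `<=` f @^-1` [set b]].

Definition has_section (n : nat) : Prop :=
  exists s : B -> fibre_measures n,
    continuous s /\ cancel s (@fibre_map n).

(* The least such [n], and +oo if there is none. *)
Definition dsecat : \bar R :=
  ereal_inf [set (n%:R)%:E | n in [set n : nat | has_section n.+1]].

End dsecat.

(* Powers carry the product topology, also when X is a CW complex. *)
Definition power (X : Type) (m : nat) : Type := {ptws 'I_m -> X}.
HB.instance Definition _ (X : topologicalType) (m : nat) :=
  Topological.on (power X m).
HB.instance Definition _ (X : ptopologicalType) (m : nat) :=
  isPointed.Build (power X m) (fun=> point).

Definition deck_transformation (E B : topologicalType) (q : E -> B) :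
    set (E -> E) :=
  [set g | q \o g = q /\
    exists h : E -> E,
      [/\ continuous g, continuous h, cancel g h & cancel h g]].

Section orbit_space.
Variables (E B : ptopologicalType) (q : E -> B) (m : nat).

(* [q] is meant to be a universal covering, on whose total space the fundamental
   group of the base acts as the group of deck transformations. *)
Definition diagonal_rel (x y : power E m) : bool :=
  `[< exists2 g, deck_transformation q g & y = g \o x >].

Lemma diagonal_rel_refl : reflexive diagonal_rel.
Proof.
move=> x; apply/asboolP; exists id => //; split=> //.
by exists id; split=> // z; exact: cvg_id.
Qed.

Lemma diagonal_rel_sym : symmetric diagonal_rel.
Proof.
suff sub x y : diagonal_rel x y -> diagonal_rel y x.
  by move=> x y; apply/idP/idP; exact: sub.
move=> /asboolP[g [qg [h [cg ch gh hg]]] ->]; apply/asboolP.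
exists h; last by apply/funext => i /=; rewrite gh.
split; last by exists g.
by apply/funext => z; rewrite -{1}qg /= hg.
Qed.

Lemma diagonal_rel_trans : transitive diagonal_rel.
Proof.
move=> y x z /asboolP[g [qg [g' [cg cg' gK g'K]]] ->].
move=> /asboolP[h [qh [h' [ch ch' hK h'K]]] ->]; apply/asboolP.
exists (h \o g) => //; split; first by rewrite compA qh.
exists (g' \o h'); split.
- by move=> u; apply: continuous_comp; [exact: cg|exact: ch].
- by move=> u; apply: continuous_comp; [exact: ch'|exact: cg'].
- by move=> u /=; rewrite hK gK.
- by move=> u /=; rewrite g'K h'K.
Qed.

Definition diagonal_equiv :=
  EquivRel diagonal_rel diagonal_rel_refl diagonal_rel_sym diagonal_rel_trans.

Definition orbit_space := {eq_quot diagonal_equiv}.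
HB.instance Definition _ := Quotient.on orbit_space.
HB.instance Definition _ :=
  PointedTopological.copy orbit_space (quotient_topology orbit_space).

(* Independent of the representative since [q \o g = q] for a deck
   transformation [g]. *)
Definition orbit_map (c : orbit_space) : power B m :=
  fun i => q ((repr c : power E m) i).

End orbit_space.

Definition dcat1 (R : realType) (X : ptopologicalType)
    (q : universal_covering R X) : \bar R :=
  dsecat R q.

Definition dTC_diag (R : realType) (X : ptopologicalType) (m : nat)
    (q : universal_covering R X) : \bar R :=
  dsecat R (@orbit_map _ _ q m).

(* Main.v *)
Require Import Defs.
From HB Require Import structures.
From mathcomp Require Import all_boot all_order all_algebra generic_quotient.
From mathcomp Require Import all_classical all_reals all_analysis measurable_realfun lra.

Set Implicit Arguments.
Unset Strict Implicit.
Unset Printing Implicit Defensive.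

Import Order.TTheory GRing.Theory Num.Theory.
Import numFieldNormedType.Exports.

Local Open Scope classical_set_scope.
Local Open Scope ring_scope.

(** A fibrewise map of total spaces pushes finitely supported fibrewise measures
    forward, hence sections of [f_n] to sections of [f'_n].

    Upper bound: the coordinates of the universal covering of [X^m] lift to the
    universal covering [E] of [X]; together they give a map to [E^m], and so to
    the orbit space, over [X^m].

    Lower bound: restrict a section to the slice [{x0} * X^k], where
    [m = k.+1]. If [U] is an evenly covered neighbourhood of [x0], the part of
    the orbit space over [U * X^k] is a product of a sheet with [E^k], and [E^k]
    maps to the universal covering of [X^k] because it is simply connected.
    Weak convergence only tests functions defined on the whole orbit space, so
    a test function pulled back along this map is multiplied by a continuous
    function on [X] that is 1 at [x0] and 0 off [U]. Such a function exists
    because CW complexes are normal (Tietze's theorem, cell by cell). *)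

(** * Covering spaces *)

Lemma within_continuousP (T S : topologicalType) (A : set T) (f : T -> S) :
  {within A, continuous f} <->
  forall x, A x -> forall U, nbhs (f x) U -> nbhs x [set y | A y -> U (f y)].
Proof.
split=> [/subspace_continuousP cf x Ax U fU|cf].
  by have := cf x Ax U fU; rewrite nbhs_filterE/= nbhs_filterE.
apply/subspace_continuousP => x Ax U fU.
by have := cf x Ax U fU.
Qed.

Lemma within_comp (T S W : topologicalType) (A : set T) (B : set S)
    (f : T -> S) (g : S -> W) :
  {within A, continuous f} -> {within B, continuous g} ->
  (forall x, A x -> B (f x)) -> {within A, continuous (g \o f)}.
Proof.
move=> /within_continuousP cf /within_continuousP cg AB.
apply/within_continuousP => x Ax U gfU; have gU := cg _ (AB x Ax) U gfU.
apply: filterS (cf x Ax _ gU) => y /= h Ay.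
by apply: h => //; exact: AB.
Qed.

Lemma within_comp_continuous (T S W : topologicalType) (A : set T)
    (f : T -> S) (g : S -> W) :
  {within A, continuous f} -> continuous g -> {within A, continuous (g \o f)}.
Proof.
move=> cf cg; apply: (within_comp (B := setT) cf) => //.
exact: continuous_subspaceT.
Qed.

Lemma within_sub (T S : topologicalType) (A B : set T) (f : T -> S) :
  B `<=` A -> {within A, continuous f} -> {within B, continuous f}.
Proof. by move=> BA; apply: continuous_subspaceW. Qed.

Lemma within_eq (T S : topologicalType) (A : set T) (f g : T -> S) :
  (forall x, A x -> f x = g x) ->
  {within A, continuous f} -> {within A, continuous g}.
Proof.
by move=> fg; apply: subspace_eq_continuous => x; rewrite inE => /fg.
Qed.

Lemma within_pair (T S W : topologicalType) (A : set T)
    (f : T -> S) (g : T -> W) :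
  {within A, continuous f} -> {within A, continuous g} ->
  {within A, continuous (fun x => (f x, g x))}.
Proof.
move=> /within_continuousP cf /within_continuousP cg.
apply/within_continuousP => x Ax U [[V1 V2] /= [fV gV] VU].
apply: filterS2 (cf x Ax _ fV) (cg x Ax _ gV) => y fy gy Ay.
by apply: VU; split; [exact: fy|exact: gy].
Qed.

Lemma comp_continuous (T S W : topologicalType) (f : T -> S) (g : S -> W) :
  continuous f -> continuous g -> continuous (g \o f).
Proof.
by move=> cf cg x; apply: continuous_comp; [exact: cf|exact: cg].
Qed.

Lemma continuous_pair (T S W : topologicalType) (f : T -> S) (g : T -> W) :
  continuous f -> continuous g -> continuous (fun x => (f x, g x)).
Proof.
move=> cf cg x U [[V1 V2] /= [fV gV] VU].
have nf : nbhs x (f @^-1` V1) := cf x _ fV.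
have ng : nbhs x (g @^-1` V2) := cg x _ gV.
suff : nbhs x [set y | U (f y, g y)] by [].
by apply: filterS2 nf ng => y fy gy; exact: VU.
Qed.

Lemma closed_preimage (S T : topologicalType) (f : S -> T) (A : set T) :
  continuous f -> closed A -> closed (f @^-1` A).
Proof. by move=> /continuous_closedP; exact. Qed.

(** Both [P] and its complement are relatively open in [A], so [P] cuts out a nonempty clopen part
    of [A], which is everything. *)
Lemma locally_constant_connected (T : topologicalType) (A P : set T) :
  connected A ->
  (forall x, A x -> nbhs x [set y | A y -> P x <-> P y]) ->
  forall x y, A x -> A y -> P x -> P y.
Proof.
move=> cA lc x y Ax Ay Px.
have openP (Q : set T) :
    (forall x, A x -> nbhs x [set y | A y -> Q x <-> Q y]) ->
    exists2 C, open C & A `&` Q = A `&` C.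
  move=> lcQ; exists [set y | A y -> Q y]°; first exact: open_interior.
  apply/seteqP; split=> z /= [Az Qz]; split=> //.
    by apply: filterS (lcQ z Az) => w /= h /h [+ _]; exact.
  exact: (nbhs_singleton Qz).
suff AP : A `&` P = A by have : A y by []; rewrite -AP => -[].
apply: cA; first by exists x.
  by have [C oC AC] := openP P lc; exists C.
have [C oC AC] : exists2 C, open C & A `&` ~` P = A `&` C.
  apply: openP => z Az; apply: filterS (lc z Az) => w /= h Aw.
  by have [h1 h2] := h Aw; split=> Q1 Q2; apply: Q1; auto.
exists (~` C); first exact: open_closedC.
apply/seteqP; split=> z [Az].
  move=> Pz; split=> // Cz.
  by have [] : (A `&` ~` P) z by rewrite AC.
move=> nCz; split=> //; apply: contrapT => nP; apply: nCz.
by have [] : (A `&` C) z by rewrite -AC.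
Qed.

Section covering.
Variables (E B : topologicalType) (q : E -> B).
Hypothesis qcov : covering_map q.

Lemma covering_sheet (e : E) :
  exists (U : set B) (V : set E) (s : B -> E),
  [/\ open U /\ U (q e), open V /\ V e,
      {within U, continuous s}, (forall v, V v -> U (q v) /\ s (q v) = v) &
      (forall u, U u -> V (s u) /\ q (s u) = u)].
Proof.
have [_ /(_ (q e)) [U [S [[oU Ue] oS _ qU SU]]]] := qcov.
have : (q @^-1` U) e by [].
rewrite qU => -[V SV Ve]; have [s [_ cs sV sU]] := SU V SV.
by exists U, V, s; split=> //; split=> //; exact: oS.
Qed.

(* Two points over [b] lie in the same sheet or in disjoint sheets over a
   neighbourhood of [b]; nearby lifts stay equal or stay different. *)
Lemma lift_unique (T : topologicalType) (A : set T) (F G : T -> E) :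
  connected A -> {within A, continuous F} -> {within A, continuous G} ->
  (forall x, A x -> q (F x) = q (G x)) ->
  forall x y, A x -> A y -> F x = G x -> F y = G y.
Proof.
move=> cA /within_continuousP cF /within_continuousP cG FG.
apply: (locally_constant_connected (P := [set x | F x = G x]) cA) => x Ax.
have [_ /(_ (q (F x))) [U [S [[oU Ux] oS tS qU SU]]]] := qcov.
have : (q @^-1` U) (F x) by [].
rewrite qU => -[V SV VF]; have oV := oS V SV.
have : (q @^-1` U) (G x) by rewrite /= -FG.
rewrite qU => -[W SW WG]; have oW := oS W SW.
have FV := cF x Ax V (open_nbhs_nbhs (conj oV VF)).
have GW := cG x Ax W (open_nbhs_nbhs (conj oW WG)).
have inj z1 z2 : V z1 -> V z2 -> q z1 = q z2 -> z1 = z2.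
  have [s [_ _ sV _]] := SU V SV.
  by move=> /sV[_ e1] /sV[_ e2] e; rewrite -e1 e e2.
have [VW|VW] := pselect (V = W).
  subst W; apply: filterS2 FV GW => y /= Vy Wy Ay.
  by split=> _; apply: inj => //; auto.
apply: filterS2 FV GW => y /= Vy Wy Ay.
have dis z : V z -> W z -> False.
  move=> Vz Wz; apply: VW; apply: tS => //.
  by exists z.
split=> h; exfalso.
  by apply: (dis (F x)) => //; rewrite h.
by apply: (dis (F y)); [exact: Vy|rewrite h; exact: Wy].
Qed.

(** The starting point is arbitrary in [A], so that a lift found on one piece can be continued on
    another from any common point. *)
Definition liftable (T : topologicalType) (g : T -> B) (A : set T) :=
  forall y e, A y -> q e = g y -> exists F : T -> E,
    [/\ {within A, continuous F}, (forall x, A x -> q (F x) = g x) & F y = e].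

Lemma liftable_local (T : topologicalType) (g : T -> B) (A : set T) (x : T) :
  {within A, continuous g} -> A x ->
  exists2 O, nbhs x O & forall A', A' `<=` A `&` O -> liftable g A'.
Proof.
move=> cg Ax; have /within_continuousP cg' := cg.
have [_ /(_ (g x)) [U [S [[oU Ux] oS _ qU SU]]]] := qcov.
exists [set y | A y -> U (g y)].
  exact: cg' (open_nbhs_nbhs (conj oU Ux)).
move=> A' A'O y e A'y qe.
have AU z : A' z -> U (g z) by move=> /A'O[Az]; exact.
have : (q @^-1` U) e by rewrite /= qe; exact: AU.
rewrite qU => -[V SV Ve]; have [s [_ cs sV sU]] := SU V SV.
exists (s \o g); split => //=.
- apply: within_comp cs AU; apply: within_sub cg.
  by move=> z /A'O[].
- by move=> z /AU /sU[].
- by rewrite -qe; have [_] := sV e Ve.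
Qed.

(** The lift over [A2] starts from the value of the first lift at a common point. By uniqueness the
    two agree on the connected intersection, and closedness allows gluing. *)
Lemma liftableU (T : topologicalType) (g : T -> B) (A1 A2 : set T) :
  closed A1 -> closed A2 -> A1 `&` A2 !=set0 -> connected (A1 `&` A2) ->
  liftable g A1 -> liftable g A2 -> liftable g (A1 `|` A2).
Proof.
(* By symmetry the prescribed point may be taken in [A1]. *)
wlog suff main : A1 A2 / forall (cl1 : closed A1) (cl2 : closed A2)
    (n0 : A1 `&` A2 !=set0) (c12 : connected (A1 `&` A2))
    (l1 : liftable g A1) (l2 : liftable g A2) y e, A1 y -> q e = g y ->
    exists F : T -> E, [/\ {within A1 `|` A2, continuous F},
      (forall x, (A1 `|` A2) x -> q (F x) = g x) & F y = e].
  move=> cl1 cl2 n0 c12 l1 l2 y e [A1y|A2y]; first exact: main.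
  by rewrite setUC; apply: main => //; rewrite setIC.
move=> cl1 cl2 [w [A1w A2w]] c12 l1 l2 y e A1y qe.
have [F [cF qF Fy]] := l1 y e A1y qe.
have [G [cG qG Gw]] := l2 w (F w) A2w (qF w A1w).
have FG x : A1 x -> A2 x -> F x = G x.
  move=> A1x A2x; apply: (lift_unique c12 (F := F) (G := G) _ _ _
    (conj A1w A2w)) => //.
  - by apply: within_sub cF => z [].
  - by apply: within_sub cG => z [].
  - by move=> z [? ?]; rewrite qF// qG.
exists (fun x => if `[< A1 x >] then F x else G x); split.
- apply: withinU_continuous => //.
    by apply: within_eq cF => x A1x; rewrite asboolT.
  apply: within_eq cG => x A2x; case: asboolP => // A1x.
  by rewrite FG.
- by move=> x; case: asboolP => [A1x _|nA1 []//]; [exact: qF|exact: qG].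
- by rewrite asboolT.
Qed.

End covering.

(** * Subdivision of the interval and lifting over the square *)

Section interval.
Variable R : realType.
Local Notation I := (`[0, 1]%classic : set R).

(** A substitute for subdividing by a Lebesgue number: the set of endpoints reachable from 0 is
    locally constant, and the interval is connected. *)
Lemma cousin_interval (P : R -> R -> Prop) :
  (forall a b c, 0 <= a -> a <= b -> b <= c -> c <= 1 ->
    P a b -> P b c -> P a c) ->
  (forall x, 0 <= x <= 1 -> exists2 d, 0 < d & forall a b, 0 <= a -> a <= b ->
    b <= 1 -> `|x - a| < d -> `|x - b| < d -> P a b) ->
  P 0 1.
Proof.
move=> Padd Ploc; pose Q t := forall s, 0 <= s -> s <= t -> P 0 s.
suff : Q 1 by apply.
have I01 : connected I by apply/segment_connected.
have mI (x : R) : I x <-> 0 <= x <= 1 by rewrite /= in_itv.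
apply: (locally_constant_connected (P := Q) I01 _ (x := 0)).
- move=> x /mI x01; have [d d0 dP] := Ploc x x01.
  move/andP: x01 => [x0 x1].
  have step t t' : 0 <= t -> t <= t' -> t' <= 1 -> `|x - t| < d ->
      `|x - t'| < d -> Q t -> Q t'.
    move=> t0 tt' t'1 xt xt' Qt s s0 st'.
    have [st|ts] := leP s t; first exact: Qt.
    apply: (Padd 0 t) => //; [exact: ltW|lra|exact: Qt|].
    apply: dP => //; [exact: ltW|lra|].
    move: xt xt'; rewrite !ltr_norml => /andP[? ?] /andP[? ?].
    apply/andP; split; lra.
  apply/nbhs_ballP; exists d => //= y xy /mI/andP[y0 y1].
  rewrite /ball/= in xy.
  have xx : `|x - x| < d by rewrite subrr normr0.
  have [xley|yltx] := leP x y.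
    split; first exact: step.
    by move=> Qy s s0 sx; apply: Qy => //; lra.
  split; first by move=> Qx s s0 sy; apply: Qx => //; lra.
  by apply: step => //; exact: ltW.
- by apply/mI; lra.
- by apply/mI; lra.
- move=> s s0 s0'; have -> : s = 0 by lra.
  have [|d d0 dP] := Ploc 0; first lra.
  by apply: dP; rewrite ?subrr ?normr0//; lra.
Qed.

(** Subdivision is run twice: horizontal strips are stacked, and each thin strip is assembled from
    small rectangles. Neighbouring pieces meet in a segment, which is connected, so [liftableU]
    applies. *)
Lemma square_liftable (E B : topologicalType) (q : E -> B) (g : R * R -> B) :
  covering_map q -> {within I `*` I, continuous g} ->
  liftable q g (I `*` I).
Proof.
move=> qcov cg.
pose rect (a b c d : R) : set (R * R) := `[a, b] `*` `[c, d].
have clrect a b c d : closed (rect a b c d).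
  apply: closedI.
    apply: (closed_preimage (f := fst)); first by move=> z; exact: cvg_fst.
    exact: interval_closed.
  apply: (closed_preimage (f := snd)); first by move=> z; exact: cvg_snd.
  exact: interval_closed.
have inrect a b c d (z : R * R) : rect a b c d z <->
    (a <= z.1 <= b) /\ (c <= z.2 <= d).
  by rewrite /rect /= !in_itv.
have corect a b (h : R -> R * R) (A : set (R * R)) : a <= b ->
    (forall z, A z <-> exists2 x, a <= x <= b & h x = z) ->
    continuous h -> connected A.
  move=> ab Ah ch; have -> : A = h @` `[a, b].
    apply/seteqP; split=> z.
      by move=> /Ah[x xab <-]; exists x => //=; rewrite in_itv.
    by move=> [x /=]; rewrite in_itv/= => xab <-; apply/Ah; exists x.
  apply: connected_continuous_connected; first exact: segment_connected.
  exact: continuous_subspaceT.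
apply: (cousin_interval (P := fun c d => liftable q g (rect 0 1 c d))).
  move=> c d e c0 cd de e1 l1 l2.
  have -> : rect 0 1 c e = rect 0 1 c d `|` rect 0 1 d e.
    apply/seteqP; split=> [z /inrect[z1 z2]|z [/inrect[z1 z2]|/inrect[z1 z2]]].
    - have [zd|dz] := leP z.2 d; [left|right]; apply/inrect; split => //; lra.
    - apply/inrect; split => //; lra.
    - apply/inrect; split => //; lra.
  apply: liftableU => //.
    by exists (0, d); split; apply/inrect => /=; split; lra.
  apply: (corect 0 1 (fun x => (x, d)) _ ltac:(lra)).
    move=> z; split.
      move=> [/inrect[z1 z2] /inrect[_ z2']]; exists z.1 => //.
      have -> : d = z.2 by lra.
      by case: (z).
    by move=> [x x01 <-]; split; apply/inrect => /=; split; lra.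
  by apply: continuous_pair; [by move=> ?; exact: cvg_id|exact: cst_continuous].
move=> y y01.
(* The inner predicate carries the admissible height [d] of the strip around [y]; joining two
   intervals takes the minimum of their heights. *)
apply: (cousin_interval (P := fun a b => exists2 d, 0 < d &
  forall c e, 0 <= c -> c <= e -> e <= 1 -> `|y - c| < d -> `|y - e| < d ->
  liftable q g (rect a b c e))).
  move=> a b b' a0 ab bb' b'1 [d1 d10 H1] [d2 d20 H2].
  exists (Num.min d1 d2); first by rewrite lt_min d10.
  move=> c e c0 ce e1; rewrite !lt_min => /andP[c1 c2] /andP[e1' e2].
  have -> : rect a b' c e = rect a b c e `|` rect b b' c e.
    apply/seteqP; split=> [z /inrect[z1 z2]|z [/inrect[z1 z2]|/inrect[z1 z2]]].
    - have [zd|dz] := leP z.1 b; [left|right]; apply/inrect; split => //; lra.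
    - apply/inrect; split => //; lra.
    - apply/inrect; split => //; lra.
  apply: liftableU; [exact: qcov|exact: clrect|exact: clrect|..].
  - by exists (b, c); split; apply/inrect => /=; split; lra.
  - apply: (corect c e (fun x => (b, x)) _ ce); last first.
      by apply: continuous_pair; [exact: cst_continuous|by move=> ?; exact: cvg_id].
    move=> z; split.
      move=> [/inrect[z1 z2] /inrect[z1' _]]; exists z.2 => //.
      have -> : b = z.1 by lra.
      by case: (z).
    by move=> [x x01 <-]; split; apply/inrect => /=; split; lra.
  - exact: H1.
  - exact: H2.
move=> x x01.
have xyI : (I `*` I) (x, y) by split; rewrite /= in_itv.
have [N nN Nl] := liftable_local qcov cg xyI.
have /nbhs_ballP[d /= d0 dO] := nN; exists d => //.
move=> a b a0 ab b1 xa xb; exists d => // c e c0 ce e1 yc ye.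
apply: Nl => -[z1 z2] /inrect/= [z1ab z2ce]; split.
  by split; rewrite /= in_itv/=; lra.
apply: dO; split; rewrite /ball/=.
  move: xa xb; rewrite !ltr_norml => /andP[? ?] /andP[? ?].
  apply/andP; split; lra.
move: yc ye; rewrite !ltr_norml => /andP[? ?] /andP[? ?].
apply/andP; split; lra.
Qed.

End interval.

(** * Path lifting and the lifting criterion *)

Section paths.
Variable R : realType.
Local Notation I := (`[0, 1]%classic : set R).

Lemma unit_itvE (t : R) : I t = (0 <= t <= 1).
Proof. by rewrite /= in_itv. Qed.

Definition path_in (T : topologicalType) (A : set T) (x y : T) :=
  exists f : R -> T, [/\ {within I, continuous f}, f 0 = x, f 1 = y &
    forall t, 0 <= t <= 1 -> A (f t)].

Lemma path_in_refl (T : topologicalType) (A : set T) x : A x -> path_in A x x.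
Proof.
move=> Ax; exists (fun=> x); split=> //.
by apply: continuous_subspaceT; exact: cst_continuous.
Qed.

Lemma path_in_comp (T S : topologicalType) (A : set T) (B : set S)
    (f : T -> S) x y :
  {within A, continuous f} -> (forall z, A z -> B (f z)) ->
  path_in A x y -> path_in B (f x) (f y).
Proof.
move=> cf AB [g [cg <- <- gA]]; exists (f \o g); split => //.
  by apply: within_comp cg cf _ => t; rewrite unit_itvE; exact: gA.
by move=> t t01; apply/AB/gA.
Qed.

Lemma path_in_sub (T : topologicalType) (A B : set T) x y :
  A `<=` B -> path_in A x y -> path_in B x y.
Proof. by move=> AB [f [cf f0 f1 fA]]; exists f; split=> // t /fA/AB. Qed.

Lemma affine_continuous (a b : R) : continuous (fun t : R => a * t + b).
Proof.
move=> x; apply: cvgD; last exact: cvg_cst.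
by apply: cvgM; [exact: cvg_cst|exact: cvg_id].
Qed.

Lemma path_in_sym (T : topologicalType) (A : set T) x y :
  path_in A x y -> path_in A y x.
Proof.
move=> [f [cf f0 f1 fA]]; exists (fun t => f (-1 * t + 1)); split.
- apply: (within_comp (B := I) (g := f)) => //.
    exact/continuous_subspaceT/affine_continuous.
  by move=> t; rewrite !unit_itvE; lra.
- by rewrite -f1; congr f; lra.
- by rewrite -f0; congr f; lra.
- by move=> t t01; apply: fA; lra.
Qed.

Lemma path_in_trans (T : topologicalType) (A : set T) x y z :
  path_in A x y -> path_in A y z -> path_in A x z.
Proof.
move=> [f [cf f0 f1 fA]] [g [cg g0 g1 gA]].
exists (fun t => if t <= 1/2 then f (2 * t + 0) else g (2 * t + -1)); split.
- have -> : I = `[0, 1/2]%classic `|` `[1/2, 1]%classic.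
    apply/seteqP; split=> t; rewrite /= !in_itv/=; last lra.
    by move=> t01; have [|] := leP t (1/2) => ?; [left|right]; lra.
  apply: withinU_continuous; try exact: interval_closed.
    apply: (within_eq (f := f \o (fun t => 2 * t + 0))).
      by move=> t; rewrite /= in_itv/= => /andP[_ ->].
    apply: (within_comp (B := I)) => //.
      exact/continuous_subspaceT/affine_continuous.
    by move=> t; rewrite unit_itvE /= in_itv/=; lra.
  apply: (within_eq (f := g \o (fun t => 2 * t + -1))).
    move=> t; rewrite /= in_itv/= => t1; case: ifPn => // t2.
    have -> : t = 1/2 by lra.
    have -> : 2 * (1/2) + -1 = 0 :> R by lra.
    have -> : 2 * (1/2) + 0 = 1 :> R by lra.
    by rewrite f1 g0.
  apply: (within_comp (B := I)) => //.
    exact/continuous_subspaceT/affine_continuous.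
  by move=> t; rewrite unit_itvE /= in_itv/=; lra.
- by rewrite ifT ?mulr0 ?addr0//; lra.
- by rewrite ifF; [rewrite -g1; congr g; lra|apply/negbTE; rewrite -ltNge; lra].
- by move=> t t01; case: ifPn => ?; [apply: fA|apply: gA]; lra.
Qed.

(** Paths may use all of [U], the weak form of the notion at a single point; required at every point
    it amounts to a base of path connected open sets. *)
Definition locally_path_connected (T : topologicalType) :=
  forall (x : T) U, nbhs x U -> nbhs x (path_in U x).

Lemma path_connectedP (T : topologicalType) :
  path_connected R T -> forall x y : T, path_in setT x y.
Proof. by move=> pT x y; have [f [cf f0 f1]] := pT x y; exists f. Qed.

Section lifting.
Variables (E B : topologicalType) (q : E -> B).
Hypothesis qcov : covering_map q.

Lemma covering_continuous : continuous q.
Proof. by case: qcov. Qed.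

Lemma lift_path_unique (f g : R -> E) :
  {within I, continuous f} -> {within I, continuous g} ->
  (forall t, I t -> q (f t) = q (g t)) ->
  forall t t', I t -> I t' -> f t = g t -> f t' = g t'.
Proof.
move=> cf cg fg t t' It It'; apply: (lift_unique qcov _ cf cg fg It It').
exact: segment_connected.
Qed.

Lemma lift_unique_path_connected (T : topologicalType) (F G : T -> E) :
  path_connected R T -> continuous F -> continuous G ->
  (forall x, q (F x) = q (G x)) -> forall x y, F x = G x -> F y = G y.
Proof.
move=> pT cF cG FG x y; have [f [cf <- <-]] := pT x y.
apply: (lift_path_unique (f := F \o f) (g := G \o f)).
- exact: within_comp_continuous.
- exact: within_comp_continuous.
- by move=> t _; exact: FG.
- by rewrite unit_itvE; lra.
- by rewrite unit_itvE; lra.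
Qed.

(** A path is a homotopy that is constant in the first variable, so lifting over the square
    applies. *)
Lemma path_lift (f : R -> B) (e : E) :
  {within I, continuous f} -> q e = f 0 ->
  exists g : R -> E, [/\ {within I, continuous g},
    (forall t, I t -> q (g t) = f t) & g 0 = e].
Proof.
move=> cf qe.
have cg : {within I `*` I, continuous (f \o snd : R * R -> B)}.
  apply: (within_comp (B := I)) => //; last by move=> z [].
  by apply: continuous_subspaceT => z; exact: cvg_snd.
have I0 : I 0 by rewrite unit_itvE; lra.
have [F [cF qF F0]] := square_liftable qcov cg (conj I0 I0 : (I `*` I) (0, 0))
  qe.
exists (fun t => F (0, t)); split => // [|t It]; last by rewrite qF.
apply: (within_comp (f := fun t => (0, t)) _ cF) => //.
apply: continuous_subspaceT; apply: continuous_pair.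
  exact: cst_continuous.
by move=> ?; exact: cvg_id.
Qed.

Variables (T : topologicalType) (f : T -> B).
Hypotheses (T1 : simply_connected R T) (Tloc : locally_path_connected T).
Hypothesis cf : continuous f.

(** The fibre product: a path in it is a path in [T] together with a lift of its image in [B]. *)
Let pullback : set (T * E) := [set z | f z.1 = q z.2].

(* Lifting a null-homotopy of the loop: the lift is constant on the three sides
   of the square where the homotopy is constant. *)
Let pullback_loop x e e' : path_in pullback (x, e) (x, e') -> e = e'.
Proof.
move=> [g [cg g0 g1 gP]].
have I0 : I 0 by rewrite unit_itvE; lra.
have I1 : I 1 by rewrite unit_itvE; lra.
have cg1 : {within I, continuous (fst \o g)}.
  by apply: within_comp_continuous cg _ => z; exact: cvg_fst.
have [_ /(_ _ cg1)[|K [cK Ke]]] := T1; first by rewrite /= g0 g1.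
have KE t : I t -> [/\ K (0, t) = (g t).1, K (1, t) = x,
    K (t, 0) = x & K (t, 1) = x].
  by move=> It; have /= := Ke t It; rewrite g0.
have I00 : (I `*` I) (0, 0) by [].
have qe : q e = f (K (0, 0)).
  have [-> _ _ _] := KE 0 I0.
  by have := gP 0; rewrite g0 /pullback /= => ->//; lra.
have [F [cF qF F0]] := square_liftable qcov
  (within_comp_continuous cK cf) I00 qe.
have cedge (h : R -> R * R) : continuous h -> (forall t, I t -> (I `*` I) (h t))
    -> {within I, continuous (F \o h)}.
  by move=> ch hI; apply: (within_comp _ cF hI); exact: continuous_subspaceT.
have cl (a : R) : continuous (fun t : R => (a, t)).
  by apply: continuous_pair; [exact: cst_continuous|move=> ?; exact: cvg_id].
have cr (a : R) : continuous (fun t : R => (t, a)).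
  by apply: continuous_pair; [move=> ?; exact: cvg_id|exact: cst_continuous].
have edge (h : R -> R * R) : continuous h -> (forall t, I t -> (I `*` I) (h t))
    -> (forall t, I t -> K (h t) = x) -> F (h 1) = F (h 0).
  move=> ch hI hK; apply: (lift_path_unique (f := F \o h)
    (g := fun=> F (h 0)) _ _ _ I0 I1) => //.
  - exact: cedge.
  - by apply: continuous_subspaceT; exact: cst_continuous.
  - by move=> t It; rewrite /= (qF _ (hI t It)) (qF _ (hI 0 I0)) /= !hK.
have F01 : F (0, 1) = e.
  rewrite -(edge _ (cr 1) _ _) => [|t It|t It]; [|by split|by case: (KE t It)].
  rewrite (edge _ (cl 1) _ _) => [|t It|t It]; [|by split|by case: (KE t It)].
  by rewrite (edge _ (cr 0) _ _) => [|t It|t It]; [|by split|by case: (KE t It)].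
(* On the remaining side, [F] and the second component of [g] lift the same path from [e], hence
   have the same end. *)
rewrite -F01; have <- : (g 1).2 = e' by rewrite g1.
apply: (lift_path_unique (f := F \o (fun t => (0, t))) (g := snd \o g)
  _ _ _ I0 I1).
- by apply: cedge (cl 0) _ => t It; split.
- by apply: within_comp_continuous cg _ => z; exact: cvg_snd.
- move=> t It; rewrite /= qF /=; last by split.
  have [-> _ _ _] := KE t It.
  by rewrite unit_itvE in It; exact: gP.
- by rewrite /= g0 F0.
Qed.

(** [F x] is the end of the lift along any path from [x0] to [x]; [pullback_loop] makes it
    independent of the path. *)
Theorem lifting x0 e0 : q e0 = f x0 ->
  exists F : T -> E, [/\ continuous F, (forall x, q (F x) = f x) & F x0 = e0].
Proof.
move=> qe0.
have ex x : exists e, path_in pullback (x0, e0) (x, e).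
  have [g [cg g0 g1 _]] := path_connectedP (proj1 T1) x0 x.
  have [|h [ch hq h0]] := path_lift (e := e0) (within_comp_continuous cg cf).
    by rewrite /= g0.
  exists (h 1), (fun t => (g t, h t)); split => //.
  - exact: within_pair.
  - by rewrite g0 h0.
  - by rewrite g1.
  - by move=> t t01; rewrite /pullback /= hq// unit_itvE.
have [F FP] := choice ex; exists F.
have uF x e : path_in pullback (x0, e0) (x, e) -> F x = e.
  move=> p; apply: (@pullback_loop x).
  exact: path_in_trans (path_in_sym (FP x)) p.
have qF x : q (F x) = f x.
  by have [g [_ _ g1 /(_ 1)]] := FP x; rewrite g1 /pullback /= => ->//; lra.
split=> //; last by apply: uF; exact: path_in_refl.
move=> x; have [U [V [s [[oU Ux] [oV Vx] cs sV sU]]]] := covering_sheet qcov (F x).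
rewrite qF in Ux.
have nU : nbhs x (f @^-1` U) by apply: cf; exact: open_nbhs_nbhs.
(* Along a path staying over [U], the local inverse [s] provides the lift. Hence [F] is [s \o f]
   near [x], which gives continuity. *)
have Fs : forall y, path_in (f @^-1` U) x y -> F y = s (f y).
  move=> y xy; apply: uF; apply: path_in_trans (FP x) _.
  have -> : F x = s (f x) by rewrite -qF; have [] := sV _ Vx.
  apply: (path_in_comp (f := fun z => (z, s (f z)))) xy.
    apply: within_pair.
      by apply: continuous_subspaceT => ?; exact: cvg_id.
    by apply: (within_comp _ cs) => //; exact: continuous_subspaceT.
  by move=> z /sU[_]; rewrite /pullback /= => ->.
have nx := Tloc nU.
have /within_continuousP cs' := cs.
have Fx : F x = s (f x) by apply: Fs; apply: path_in_refl.
move=> W; rewrite Fx => /(cs' _ Ux) nW.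
suff : nbhs x [set y | W (F y)] by [].
have nfW : nbhs x (f @^-1` [set y | U y -> W (s y)]) := cf nW.
apply: filterS3 nfW nx nU => y /= h1 h2 h3.
by rewrite Fs//; exact: h1.
Qed.

End lifting.

End paths.

(** * Product topology and finite powers *)

Section pointwise_topology.
Variables (I : Type) (Y : topologicalType).

Lemma cvg_ptws (F : set_system {ptws I -> Y}) (x : {ptws I -> Y}) : Filter F ->
  (forall i U, nbhs (x i) U -> F [set y | U (y i)]) -> F --> x.
Proof.
move=> FF Fx; apply/cvg_sup => i U [V [[W oW <-] Wx] WU].
by apply: filterS WU _; apply: Fx; exact: open_nbhs_nbhs.
Qed.

Lemma continuous_ptws_eval i : continuous (fun x : {ptws I -> Y} => x i).
Proof.
move=> x U xU; have /cvg_sup/(_ i) : nbhs x --> x by [].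
by apply; exact: initial_continuous.
Qed.

Lemma continuous_ptws (T : topologicalType) (f : T -> {ptws I -> Y}) :
  (forall i, continuous (fun t => f t i)) -> continuous f.
Proof. by move=> cf x; apply: cvg_ptws => i U xU; exact: (cf i x). Qed.

End pointwise_topology.

Section power.
Variables (Y : topologicalType) (m : nat).

Lemma cvg_power (F : set_system (power Y m)) (x : power Y m) : Filter F ->
  (forall i U, nbhs (x i) U -> F [set y | U (y i)]) -> F --> x.
Proof. exact: cvg_ptws. Qed.

Lemma continuous_power_proj i : continuous (fun x : power Y m => x i).
Proof. exact: continuous_ptws_eval. Qed.

Lemma continuous_power_coord (T : topologicalType) (f : T -> power Y m) i :
  continuous f -> continuous (fun t => f t i).
Proof. by move=> cf; exact: (comp_continuous cf (@continuous_power_proj i)). Qed.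

Lemma continuous_power (T : topologicalType) (f : T -> power Y m) :
  (forall i, continuous (fun t => f t i)) -> continuous f.
Proof. exact: continuous_ptws. Qed.

Lemma within_continuous_power (T : topologicalType) (A : set T)
    (f : T -> power Y m) :
  (forall i, {within A, continuous (fun t => f t i)}) ->
  {within A, continuous f}.
Proof.
move=> cf; apply/subspace_continuousP => x Ax.
apply: cvg_power => i U xU.
by have /subspace_continuousP/(_ x Ax _ xU) := cf i.
Qed.

Lemma nbhs_power_box (x : power Y m) (V : 'I_m -> set Y) :
  (forall i, nbhs (x i) (V i)) -> nbhs x [set y | forall i, V i (y i)].
Proof.
move=> xV; apply: (@filter_forall _ _ (fun i => [set y : power Y m | V i (y i)]) _
  (nbhs_filter x)) => i.
exact: (continuous_power_proj (xV i)).
Qed.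

(** The boxes generate a filter that converges to [x] coordinatewise, so it contains every
    neighbourhood of [x]. *)
Lemma nbhs_powerP (x : power Y m) (U : set (power Y m)) : nbhs x U ->
  exists2 V : 'I_m -> set Y, (forall i, nbhs (x i) (V i)) &
    [set y | forall i, V i (y i)] `<=` U.
Proof.
pose D : set ('I_m -> set Y) := [set V | forall i, nbhs (x i) (V i)].
pose box (V : 'I_m -> set Y) : set (power Y m) := [set y | forall i, V i (y i)].
have FF : Filter (filter_from D box).
  apply: filter_from_filter; first by exists (fun=> setT) => i; exact: filterT.
  move=> V W DV DW; exists (fun i => V i `&` W i).
    by move=> i; exact: filterI.
  by move=> y VW; split=> i; have [] := VW i.
have FX : filter_from D box --> x.
  apply: cvg_power => i U' xU'; exists (fun j => if j == i then U' else setT).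
    by move=> j; case: eqP => [->//|_]; exact: filterT.
  by move=> y /(_ i); rewrite eqxx.
by move=> /FX[V DV VU]; exists V.
Qed.

Lemma closed_power_point : (forall y : Y, closed [set y]) ->
  forall x : power Y m, closed [set x].
Proof.
move=> cY x; have -> : [set x] =
    \bigcap_i ((fun y : power Y m => y i) @^-1` [set x i]).
  apply/seteqP; split=> [y -> i //|y yx].
  by apply/funext => i; exact: yx.
apply: closed_bigI => i _; apply: closed_preimage => //.
exact: continuous_power_proj.
Qed.

Variable R : realType.

(** Paths are assembled coordinatewise; there are finitely many coordinates, so a product of
    neighbourhoods is again a neighbourhood. *)
Lemma locally_path_connected_power :
  locally_path_connected R Y -> locally_path_connected R (power Y m).
Proof.
move=> lY x U /nbhs_powerP[V xV VU].
apply: filterS (nbhs_power_box (fun i => lY _ _ (xV i))) => y.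
move=> xy; have [f fP] := choice xy.
apply: (@path_in_sub R (power Y m) _ U x y VU); exists (fun t i => f i t); split.
- by apply: within_continuous_power => i; have [] := fP i.
- by apply/funext => i; have [] := fP i.
- by apply/funext => i; have [] := fP i.
- by move=> t t01 i; have [_ _ _ ] := fP i; exact.
Qed.

Lemma simply_connected_power :
  simply_connected R Y -> simply_connected R (power Y m).
Proof.
move=> [pY sY]; split=> [x y|f cf f01].
  have [f fP] := choice (fun i => pY (x i) (y i)).
  exists (fun t i => f i t); split.
  - by apply: within_continuous_power => i; have [] := fP i.
  - by apply/funext => i; have [] := fP i.
  - by apply/funext => i; have [] := fP i.
have cfi i : {within `[0, 1], continuous (fun t => f t i)}.
  exact: (within_comp_continuous cf (@continuous_power_proj i)).
have [H HP] := choice (fun i => sY _ (cfi i) (congr1 (fun x => x i) f01)).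
exists (fun z i => H i z); split.
  by apply: within_continuous_power => i; have [] := HP i.
by move=> t t01; split; apply/funext => i; have [_ /(_ t t01)[]] := HP i.
Qed.

End power.

(** * Total spaces of coverings and deck transformations *)

Section covering_lemmas.
Variables (R : realType) (E B : topologicalType) (q : E -> B).
Hypothesis qcov : covering_map q.

(** Short paths in the base are carried into the sheet by the local inverse [s]. *)
Lemma locally_path_connected_covering :
  locally_path_connected R B -> locally_path_connected R E.
Proof.
move=> lB e N eN; have [U [V [s [[oU Ue] [oV Ve] cs sV sU]]]] :=
  covering_sheet qcov e.
have se : s (q e) = e by have [] := sV e Ve.
have /within_continuousP/(_ _ Ue N) := cs; rewrite se => /(_ eN) nN.
have nU : nbhs (q e) U by exact: open_nbhs_nbhs.
have nV : nbhs e V by exact: open_nbhs_nbhs.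
have := covering_continuous qcov (lB _ _ (filterI nU nN)) => nE.
have nE' : nbhs e (q @^-1` path_in R (U `&` [set y | U y -> N (s y)]) (q e)).
  exact: nE.
apply: filterS2 nV nE' => e' Ve' /= p.
have <- : s (q e') = e' by have [] := sV e' Ve'.
rewrite -{1}se; apply: path_in_comp p; last by move=> y [Uy]; exact.
by apply: within_sub cs => y [].
Qed.

(** Over an evenly covered set either all points or none have a preimage, so the image is locally
    constant; [e] makes it nonempty. *)
Lemma covering_surjective (e : E) : connected [set: B] ->
  forall b, exists e', q e' = b.
Proof.
move=> cB b; suff : range q b by move=> [e' _ <-]; exists e'.
apply: (locally_constant_connected (P := range q) cB _ (x := q e)) => //.
move=> b' _; have [_ /(_ b')[U [S [[oU Ub] oS _ qU SU]]]] := qcov.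
have nU : nbhs b' U by exact: open_nbhs_nbhs.
have key y y' : U y -> U y' -> range q y -> range q y'.
  move=> Uy Uy' [e' _ qe'].
  have : (q @^-1` U) e' by rewrite /= qe'.
  rewrite qU => -[V SV _]; have [s [_ _ _ /(_ _ Uy')[_ <-]]] := SU V SV.
  by exists (s y').
by apply: filterS nU => y Uy _; split; exact: key.
Qed.

Lemma deck_transformationP g : deck_transformation q g ->
  continuous g /\ forall e, q (g e) = q e.
Proof.
move=> [qg [h [cg _ _ _]]]; split=> // e.
by rewrite -[in RHS]qg.
Qed.

Hypotheses (scE : simply_connected R E) (lE : locally_path_connected R E).

(** Deck transformations are lifts of [q] through [q] itself, so agreement at one point
    propagates. *)
Lemma deck_transformation_unique g h e : deck_transformation q g ->
  deck_transformation q h -> g e = h e -> g = h.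
Proof.
move=> /deck_transformationP[cg qg] /deck_transformationP[ch qh] gh.
apply/funext => x.
apply: (lift_unique_path_connected qcov (proj1 scE) cg ch _ (x := e)) => //.
by move=> z; rewrite qg qh.
Qed.

(** Lifting [q] through itself gives one map from [e] to [e'] and one back; by uniqueness of lifts
    their composites are identities. *)
Lemma deck_transformation_transitive e e' : q e = q e' ->
  exists2 g, deck_transformation q g & g e = e'.
Proof.
move=> qe; have cq := covering_continuous qcov.
have [g [cg qg ge]] := lifting qcov scE lE cq (esym qe).
have [h [ch qh he]] := lifting qcov scE lE cq qe.
have cid : continuous (id : E -> E) by move=> ?; exact: cvg_id.
exists g => //; split; first exact/funext.
exists h; split => // x.
  apply: (lift_unique_path_connected qcov (proj1 scE) (comp_continuous cg ch) cid _
    (x := e)) => /= [z|]; by rewrite ?qh ?qg// ge.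
apply: (lift_unique_path_connected qcov (proj1 scE) (comp_continuous ch cg) cid _
  (x := e')) => /= [z|]; by rewrite ?qg ?qh// he.
Qed.

End covering_lemmas.

(** * CW complexes *)

Lemma within_closed_preimage (T S : topologicalType) (A : set T) (f : T -> S)
    (C : set S) :
  closed A -> {within A, continuous f} -> closed C -> closed (A `&` f @^-1` C).
Proof.
move=> cA cf cC; move: cf => /continuous_closedP/(_ _ cC)/closed_subspaceP.
by move=> [V cV VA]; rewrite setIC -VA; exact: closedI.
Qed.

Lemma within_continuous_closed (T S : topologicalType) (A : set T)
    (f : T -> S) :
  (forall C, closed C -> closed (A `&` f @^-1` C)) -> {within A, continuous f}.
Proof.
move=> cf; apply/continuous_closedP => C cC; apply/closed_subspaceP.
by exists (A `&` f @^-1` C); [exact: cf|rewrite setIAC setIid setIC].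
Qed.

Lemma path_in_segment (R : realType) (V : normedModType R) (A : set V) v w :
  (forall t : R, 0 <= t <= 1 -> A ((1 - t) *: v + t *: w)) ->
  path_in R A v w.
Proof.
move=> Avw; exists (fun t => (1 - t) *: v + t *: w); split=> //.
- apply: continuous_subspaceT => t.
  apply: cvgD; apply: cvgZr_tmp; last exact: cvg_id.
  by apply: cvgB; [exact: cvg_cst|exact: cvg_id].
- by rewrite subr0 scale1r scale0r addr0.
- by rewrite subrr scale1r scale0r add0r.
Qed.

Section CW_complexes.
Variables (R : realType) (X : topologicalType).

Section characteristic_maps.
Variables (I : Type) (dim : I -> nat) (Phi : forall i, 'rV[R]_(dim i) -> X).
Arguments Phi : clear implicits.
Let disc i : set 'rV[R]_(dim i) := [set v | `|v| <= 1].
Let sphere i : set 'rV[R]_(dim i) := [set v | `|v| = 1].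
Let cell i : set X := Phi i @` [set v | `|v| < 1].
Arguments disc : clear implicits.
Arguments sphere : clear implicits.
Arguments cell : clear implicits.
Hypotheses (hX : hausdorff_space X)
  (Phi_cont : forall i, {within disc i, continuous (Phi i)})
  (Phi_inj : forall i, set_inj [set v | `|v| < 1] (Phi i))
  (cell_triv : trivIset setT cell) (cell_cover : \bigcup_i cell i = setT)
  (boundary : forall i, exists J : set I,
    [/\ finite_set J, (forall j, J j -> (dim j < dim i)%N) &
        Phi i @` sphere i `<=` \bigcup_(j in J) cell j])
  (weak : forall A : set X,
    closed A <-> forall i, closed (disc i `&` Phi i @^-1` A)).

Let closed_disc i : closed (disc i).
Proof.
rewrite (_ : disc i = (fun v => `|v|) @^-1` [set x | x <= 1])//.
by apply: closed_preimage; [exact: norm_continuous|exact: closed_le].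
Qed.

Let closed_sphere i : closed (sphere i).
Proof.
rewrite (_ : sphere i = (fun v => `|v|) @^-1` [set 1])//.
by apply: closed_preimage; [exact: norm_continuous|exact: closed_eq].
Qed.

Let compact_disc i : compact (disc i).
Proof.
apply: bounded_closed_compact => //; exists 1; split => // x x1 v.
by move=> /le_trans; apply; exact: ltW.
Qed.

(** The path component of [x] in an open [U] is open. In the weak topology this is checked in each
    disc: a limit point [v] of the complement with image in the component is joined to a nearby
    point of the complement by a segment whose image stays in [U]. *)
Lemma cells_locally_path_connected : locally_path_connected R X.
Proof.
move=> x N /nbhs_interior; rewrite {1}nbhsE => -[U [oU Ux] UN].
suff oP : open (path_in R U x).
  apply: filterS (open_nbhs_nbhs (conj oP (@path_in_refl R X U x Ux))) => y.
  by apply: path_in_sub => z /UN; exact: interior_subset.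
rewrite -[path_in _ _ _]setCK; apply: closed_openC; apply/weak => i v clv.
have Dv : disc i v.
  by apply: (@closed_disc i) => B /clv[w [[]]]; exists w.
split=> //; move=> /= Pv.
have Uv : U (Phi i v).
  by have [f [_ _ <- fU]] := Pv; apply: fU; lra.
have /within_continuousP/(_ v Dv U) := @Phi_cont i.
move=> /(_ (open_nbhs_nbhs (conj oU Uv)))/nbhs_ballP[e /= e0 eU].
have [w [[Dw nPw] vw]] := clv _ (nbhsx_ballx v e e0).
apply: nPw; apply: path_in_trans Pv _.
pose A := disc i `&` ball v e.
apply: (path_in_comp (A := A)); first by apply: within_sub (@Phi_cont i) => z [].
  by move=> z [Dz /eU]; exact.
apply: path_in_segment => t /andP[t0 t1]; split.
  rewrite /disc /=; apply: le_trans (ler_normD _ _) _.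
  rewrite !normrZ (ger0_norm t0) ger0_norm ?subr_ge0//.
  rewrite /disc /= in Dv Dw; nra.
rewrite -ball_normE /= in vw *.
have -> : v - ((1 - t) *: v + t *: w) = t *: (v - w).
  by rewrite scalerBl scale1r scalerBr opprD opprB addrA addrCA subrr addr0.
rewrite normrZ (ger0_norm t0); have := normr_ge0 (v - w); nra.
Qed.

(** The open cells partition [X] and the characteristic maps are injective on open cubes, so each
    point has unique coordinates. *)
Let cell_coord : exists c : X -> {i & 'rV[R]_(dim i)},
  (forall x, `|projT2 (c x)| < 1 /\ Phi _ (projT2 (c x)) = x) /\
  (forall i (v : 'rV[R]_(dim i)), `|v| < 1 -> c (Phi i v) = existT _ i v).
Proof.
have ex x : exists s : {i & 'rV[R]_(dim i)},
    `|projT2 s| < 1 /\ Phi _ (projT2 s) = x.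
  have : (\bigcup_i cell i) x by rewrite cell_cover.
  by move=> [i _ [v v1 <-]]; exists (existT _ i v).
have [c cP] := choice ex; exists c; split=> // i v v1.
have [] := cP (Phi i v); case: (c _) => j w /= w1 wv.
have ji : j = i.
  apply: cell_triv => //; exists (Phi i v); split; last by exists v.
  by exists w.
by subst j; rewrite (@Phi_inj i _ _ _ _ wv) ?inE.
Qed.

Variables F0 F1 : set X.
Hypotheses (cF0 : closed F0) (cF1 : closed F1) (F01 : F0 `&` F1 = set0).

(** A stage in the construction of a Urysohn function. The function is total, so no skeleton has to
    be formed as a space; continuity is asked only on cells of dimension below [n]. *)
Let separates n (phi : X -> R) :=
  [/\ forall x, `|phi x| <= 1, forall x, F0 x -> phi x = 0,
      forall x, F1 x -> phi x = 1 &
      forall i, (dim i < n)%N -> {within disc i, continuous (phi \o Phi i)}].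

(** The sphere is mapped into finitely many cells of lower dimension. In each closed cell the part
    where [phi] lies in [C] is compact, hence closed in the Hausdorff space [X], and so is the
    finite union of these parts. *)
Let separates_sphere n phi i : separates n phi -> dim i = n ->
  {within sphere i, continuous (phi \o Phi i)}.
Proof.
move=> [_ _ _ phic] din; apply: within_continuous_closed => C cC.
have [J [fJ dJ JS]] := boundary i.
pose K j := Phi j @` (disc j `&` (phi \o Phi j) @^-1` C).
have clK : closed (\bigcup_(j in J) K j).
  apply: (@closed_bigcup X {classic I}) => // j Jj; apply: compact_closed => //.
  apply: continuous_compact.
    by apply: within_sub (@Phi_cont j) => v [].
  apply: subclosed_compact (@compact_disc j) _ => [|v []//].
  apply: within_closed_preimage => //; apply: phic.
  by rewrite -din; exact: dJ.
have -> : sphere i `&` (phi \o Phi i) @^-1` C =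
    sphere i `&` (disc i `&` Phi i @^-1` (\bigcup_(j in J) K j)).
  apply/seteqP; split=> v [Sv].
    move=> Cv; split=> //; split; first by rewrite /disc /= Sv.
    have [|j Jj [w w1 wv]] := JS (Phi i v); first by exists v.
    exists j => //; exists w => //; split; first exact: ltW.
    by rewrite /= wv.
  by move=> [_ [j Jj [w [_ Cw] wv]]]; split=> //=; rewrite -wv.
by apply: closedI => //; exact: (proj1 (weak _)).
Qed.

(** On each disc of dimension [n], Tietze's theorem extends the values already prescribed on the
    closed set [A i]: the sphere and the preimages of [F0] and [F1]. *)
Let extend n phi : separates n phi -> exists phi',
  separates n.+1 phi' /\
  forall i x, cell i x -> (dim i < n)%N -> phi' x = phi x.
Proof.
move=> sep; have [phi1 phiF0 phiF1 phic] := sep.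
pose A i := sphere i `|` (disc i `&` Phi i @^-1` F0 `|`
  disc i `&` Phi i @^-1` F1).
(* The dimension condition sits under the existential so that one choice covers all cells; other
   dimensions get the dummy 0. *)
have exG i : exists g : 'rV[R]_(dim i) -> R, dim i = n ->
    [/\ forall v, A i v -> g v = phi (Phi i v), continuous g &
        forall v, `|g v| <= 1].
  have [din|] := pselect (dim i = n); last by exists (fun=> 0).
  have cA0 := proj1 (weak _) cF0 i; have cA1 := proj1 (weak _) cF1 i.
  have cA : {within A i, continuous (phi \o Phi i)}.
    apply: withinU_continuous => //; first exact: closedU.
      exact: separates_sphere din.
    apply: withinU_continuous => //.
      apply: (within_eq (f := fun=> 0 : R)); first by move=> v [_ /phiF0].
      by apply: continuous_subspaceT; exact: cst_continuous.
    apply: (within_eq (f := fun=> 1 : R)); first by move=> v [_ /phiF1].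
    by apply: continuous_subspaceT; exact: cst_continuous.
  have clA : closed (A i) by apply: closedU => //; exact: closedU.
  have [g [gA cg g1]] := continuous_bounded_extension
    (@pseudometric_normal R 'rV[R]_(dim i)) clA ltr01 cA (fun v _ => phi1 _).
  by exists g => _; split=> // v Av; apply/esym/gA; rewrite inE.
pose G i := sval (cid (exG i)).
have GP i : dim i = n -> [/\ forall v, A i v -> G i v = phi (Phi i v),
    continuous (G i) & forall v, `|G i v| <= 1].
  exact: (svalP (cid (exG i))).
have [c [cP cE]] := cell_coord.
(* Only open cells of dimension [n] get new values. Their boundaries lie in lower cells, where
   [phi'] is still [phi]. *)
pose phi' x := if dim (projT1 (c x)) == n then G _ (projT2 (c x)) else phi x.
have phi'E i v : `|v| < 1 ->
    phi' (Phi i v) = if dim i == n then G i v else phi (Phi i v).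
  by move=> v1; rewrite /phi' cE.
have phi'S i v : dim i = n -> sphere i v -> phi' (Phi i v) = phi (Phi i v).
  move=> din Sv; have [J [_ dJ JS]] := boundary i.
  have [|j Jj [w w1 <-]] := JS (Phi i v); first by exists v.
  by rewrite phi'E// ifF//; have := dJ j Jj; rewrite din ltn_neqAle; case: eqP.
have phi'lt i v : (dim i < n)%N -> disc i v -> phi' (Phi i v) = phi (Phi i v).
  move=> din; rewrite /disc /= le_eqVlt => /orP[/eqP Sv|v1].
    have [J [_ dJ JS]] := boundary i.
    have [|j Jj [w w1 <-]] := JS (Phi i v); first by exists v.
    have djn := ltn_trans (dJ j Jj) din.
    by rewrite phi'E// ifF//; move: djn; rewrite ltn_neqAle; case: eqP.
  by rewrite phi'E// ifF//; move: din; rewrite ltn_neqAle; case: eqP.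
have phi'F x b : (F0 `|` F1) x -> phi x = b -> phi' x = b.
  move=> Fx <-; rewrite /phi'; case: eqP => // din; have [v1 vx] := cP x.
  have [GA _ _] := GP _ din; rewrite GA ?vx//.
  by right; case: Fx => Fx; [left|right]; split; rewrite /disc /= ?vx// ltW.
exists phi'; split; last first.
  by move=> i _ [v v1 <-] din; apply: phi'lt => //; exact: ltW.
split.
- by move=> x; rewrite /phi'; case: eqP => // /GP[].
- by move=> x Fx; apply: phi'F (phiF0 _ Fx); left.
- by move=> x Fx; apply: phi'F (phiF1 _ Fx); right.
move=> i; rewrite ltnS leq_eqVlt => /orP[/eqP din|din].
  have [GA cG _] := GP i din.
  apply: (within_eq (f := G i)); last exact: continuous_subspaceT.
  move=> v; rewrite /disc /= le_eqVlt => /orP[/eqP Sv|v1].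
    by rewrite phi'S// GA//; left.
  by rewrite phi'E// din eqxx.
by apply: within_eq (phic i din) => v Dv /=; rewrite phi'lt.
Qed.

(** The value at [x] is final from the stage just above the dimension of its cell. [phi] collects
    these values, and the weak topology reduces its continuity to the discs. *)
Lemma cells_separation : exists phi : X -> R,
  [/\ continuous phi, forall x, `|phi x| <= 1, forall x, F0 x -> phi x = 0 &
      forall x, F1 x -> phi x = 1].
Proof.
(* The implication makes the extension step total, so that it can be iterated; [phi] itself is the
   default. *)
have exn n phi : exists phi', separates n phi -> separates n.+1 phi' /\
    forall i x, cell i x -> (dim i < n)%N -> phi' x = phi x.
  have [/extend[phi' h]|nsep] := pselect (separates n phi); first by exists phi'.
  by exists phi.
pose next n phi := sval (cid (exn n phi)).
(* The start is the indicator of [F1]: at stage 0 the continuity condition is vacuous. *)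
pose u := fix u n := if n is n'.+1 then next n' (u n')
  else fun x => (`[< F1 x >])%:R.
have sep n : separates n (u n).
  elim: n => [|n IH]; last by have [] := svalP (cid (exn n (u n))) IH.
  split=> //= x.
  - by case: asboolP; rewrite ?normr1 ?normr0.
  - by move=> F0x; case: asboolP => // F1x; have : (F0 `&` F1) x by []; rewrite F01.
  - by move=> F1x; rewrite asboolT.
have stable n k i x : cell i x -> (dim i < n)%N -> u (k + n)%N x = u n x.
  move=> cx din; elim: k => //= k <-.
  have [_ h] := svalP (cid (exn (k + n)%N (u (k + n)%N))) (sep _).
  by apply: h cx _; exact: leq_trans din (leq_addl _ _).
have [c [cP cE]] := cell_coord.
pose phi x := u (dim (projT1 (c x))).+1 x.
(* Stage [(dim i).+1] is final on the whole disc, boundary included, since the boundary goes to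
   lower cells. *)
have cphi i v : disc i v -> u (dim i).+1 (Phi i v) = phi (Phi i v).
  have lt j w : (dim j <= dim i)%N -> `|w| < 1 -> Phi j w = Phi i v ->
      u (dim i).+1 (Phi i v) = phi (Phi i v).
    move=> ji w1 <-; rewrite /phi cE// [projT1 _]/=.
    rewrite -(subnK (ji : (dim j).+1 <= (dim i).+1)%N).
    by apply: (@stable _ _ j) => //; exists w.
  rewrite /disc /= le_eqVlt => /orP[/eqP Sv|v1]; last exact: (lt i v).
  have [J [_ dJ JS]] := boundary i.
  have [|j Jj [w w1 wv]] := JS (Phi i v); first by exists v.
  by apply: (lt j w) => //; exact/ltnW/dJ.
have bnd x : [/\ `|phi x| <= 1, F0 x -> phi x = 0 & F1 x -> phi x = 1].
  have [h1 h2 h3 _] := sep (dim (projT1 (c x))).+1.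
  by split; [exact: h1|exact: h2|exact: h3].
exists phi; split; try by move=> x; have [] := bnd x.
apply/continuous_closedP => C cC; apply/weak => i.
have [_ _ _ /(_ i (ltnSn _)) ci] := sep (dim i).+1.
apply: (within_closed_preimage (f := phi \o Phi i)) => //.
by apply: within_eq ci => v Dv; exact: cphi.
Qed.

End characteristic_maps.

Lemma CW_locally_path_connected :
  CW_complex R X -> locally_path_connected R X.
Proof.
move=> [hX [I [dim [Phi [Pc Pi [ct cc] bd wk]]]]].
exact: (cells_locally_path_connected Pc wk).
Qed.

Lemma CW_separation (F0 F1 : set X) : CW_complex R X ->
  closed F0 -> closed F1 -> F0 `&` F1 = set0 ->
  exists phi : X -> R, [/\ continuous phi, forall x, `|phi x| <= 1,
    forall x, F0 x -> phi x = 0 & forall x, F1 x -> phi x = 1].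
Proof.
move=> [hX [I [dim [Phi [Pc Pi [ct cc] bd wk]]]]].
exact: (cells_separation hX Pc Pi ct cc bd wk).
Qed.

End CW_complexes.

(** * Pushing forward sections of fibrewise measures *)

Section finitely_supported_measures.
Variables (R : realType) (Z : ptopologicalType) (n : nat).
Variables (a : 'I_n.+1 -> R) (z : 'I_n.+1 -> borel Z).
Hypotheses (a0 : forall i, 0 <= a i) (a1 : \sum_(i < n.+1) a i = 1).

Let comb : {measure set (borel Z) -> \bar R} :=
  msum (fun k => mscale (NngNum (a0 (inord k))) \d_(z (inord k))) n.+1.

Let combE A : comb A = (\sum_(i < n.+1) (a i)%:E * \d_(z i) A)%E.
Proof. by apply: eq_bigr => i _; rewrite /mscale /= inord_val. Qed.

(** The sum of scaled Dirac measures serves as the set function itself, so the formula holds on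
    every subset, as [finitely_supported] demands. *)
Lemma exists_finitely_supported : exists P : probability (borel Z) R,
  forall A, P A = (\sum_(i < n.+1) (a i)%:E * \d_(z i) A)%E.
Proof.
have comb1 : comb setT = 1%E.
  rewrite combE -[in RHS]a1 -sumEFin.
  by apply: eq_bigr => i _; rewrite diracT mule1.
pose P : probability (borel Z) R :=
  HB.pack (comb : set (borel Z) -> \bar R) (Measure.class comb)
    (Measure_isProbability.Build _ _ _ (comb : set (borel Z) -> \bar R) comb1).
by exists P => A; rewrite -combE.
Qed.

Lemma continuous_measurable_borel (g : Z -> R) : continuous g ->
  measurable_fun [set: borel Z] (g : borel Z -> R).
Proof.
move=> /continuousP cg; apply: (measurability _ (RGenOpens.measurableE R)).
move=> _ [_ [x [y ->] <-]]; rewrite setTI; apply: sub_sigma_algebra.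
exact/cg/interval_open.
Qed.

Variable mu : probability (borel Z) R.
Hypothesis muE : forall A, mu A = (\sum_(i < n.+1) (a i)%:E * \d_(z i) A)%E.

(** For nonnegative integrands the integral is additive in the measure; the general case splits [g]
    into positive and negative parts. *)
Lemma integral_finitely_supported (g : Z -> R) : continuous g ->
  \int[mu]_x g x = \sum_(i < n.+1) a i * g (z i).
Proof.
move=> cg; have mg := continuous_measurable_borel cg.
have nonneg (h : borel Z -> \bar R) : measurable_fun setT h ->
    (forall x, 0 <= h x)%E ->
    (\int[mu]_x h x = \sum_(i < n.+1) (a i)%:E * h (z i))%E.
  move=> mh h0; rewrite (eq_measure_integral comb); last first.
    by move=> A _ _; exact: etrans (muE A) (esym (combE A)).
  rewrite ge0_integral_measure_sum//; apply: eq_bigr => i _.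
  rewrite ge0_integral_mscale//= inord_val integral_dirac//.
  by rewrite diracT mul1e.
have mE : measurable_fun setT (fun x : borel Z => (g x)%:E).
  exact/measurable_EFinP.
rewrite /Rintegral integralE !nonneg//; last 2 first.
- exact: measurable_funeneg.
- exact: measurable_funepos.
have pE x : ((fun x => (g x)%:E)^\+ x = (Num.max (g x) 0)%:E)%E.
  by rewrite funeposE EFin_max.
have nE x : ((fun x => (g x)%:E)^\- x = (Num.max (- g x) 0)%:E)%E.
  by rewrite funenegE EFin_max.
under eq_bigr do rewrite pE -EFinM.
under [X in (_ - X)%E]eq_bigr do rewrite nE -EFinM.
rewrite !sumEFin -EFinB /= -sumrB; apply: eq_bigr => i _.
rewrite -mulrBr; congr (_ * _).
by case: (leP (g _) 0) => ?; case: leP => ?; lra.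
Qed.

Lemma msupport_atom i : 0 < a i -> msupport (mu : measures R Z) (z i).
Proof.
move=> ai U oU Uzi; rewrite muE (bigD1 i)//=.
apply: (@lt_le_trans _ _ ((a i)%:E * \d_(z i) U)%E).
  by rewrite diracE mem_set// mule1 lte_fin.
by rewrite leeDl// sume_ge0// => j _; rewrite mule_ge0// lee_fin.
Qed.

Lemma msupport_sub (C : set Z) : closed C -> (forall i, 0 < a i -> C (z i)) ->
  msupport (mu : measures R Z) `<=` C.
Proof.
move=> cC Cz y ysupp; apply: contrapT => nCy.
have := ysupp (~` C) (closed_openC cC) nCy.
rewrite muE big1 ?ltxx// => i _.
have := a0 i; rewrite le_eqVlt => /orP[/eqP <-|ai]; first by rewrite mul0e.
by rewrite diracE memNset ?mule0// => /(_ (Cz _ ai)).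
Qed.

Lemma exists_atom : exists i, 0 < a i.
Proof.
apply: contrapT => na; move: a1; rewrite big1 => [/eqP|i _].
  by rewrite eq_sym oner_eq0.
have := a0 i; rewrite le_eqVlt => /orP[/eqP //|ai].
by exfalso; apply: na; exists i.
Qed.

End finitely_supported_measures.

(** * Transfer of sections along fibrewise maps *)

Section sectional_category.
Variable R : realType.

Lemma fibre_mapP (E B : ptopologicalType) (f : E -> B) n
    (mu : @fibre_measures R _ _ f n) :
  msupport (set_val mu) `<=` f @^-1` [set fibre_map mu].
Proof.
have [_ ex] := set_valP mu.
exact: (getPex ex).
Qed.

(** Some atom has positive weight and lies in the support, so the support is nonempty and determines
    the point picked by [get]. *)
Lemma fibre_map_eq (E B : ptopologicalType) (f : E -> B) n
    (mu : @fibre_measures R _ _ f n.+1) b :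
  msupport (set_val mu) `<=` f @^-1` [set b] -> fibre_map mu = b.
Proof.
move=> supp; have [[a [z [a0 a1 muE]]] _] := set_valP mu.
have [i ai] := exists_atom a0 a1.
have := msupport_atom a0 muE ai => zi.
have <- : f (z i) = b by exact: supp.
by have := fibre_mapP zi.
Qed.

(** The new section moves the atoms of [s (iota b)] by [h]. Its integral of [g] equals the integral
    of [G] against [s (iota b)], which is continuous in [b]. The condition on test functions thus
    replaces continuity of [h], which may fail in the lower bound. *)
Lemma has_section_transfer (E B E' B' : ptopologicalType) (f : E -> B)
    (f' : E' -> B') (iota : B' -> B) (h : E -> E') n :
  continuous iota ->
  (forall b, closed (f' @^-1` [set b])) ->
  (forall z b, f z = iota b -> f' (h z) = b) ->
  (forall g, @bounded_continuous R E' g -> exists2 G, @bounded_continuous R E G &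
    forall z b, f z = iota b -> G z = g (h z)) ->
  has_section R f n.+1 -> has_section R f' n.+1.
Proof.
move=> ci cf' fh ext [s [cs sK]].
(* The integral identity is recorded for all pairs [g], [G] at once, so that one choice of [mu]
   serves every test function. *)
have ex b : exists mu : @fibre_measures R _ _ f' n.+1,
    msupport (set_val mu) `<=` f' @^-1` [set b] /\
    forall g G, @bounded_continuous R E' g -> @bounded_continuous R E G ->
      (forall z, f z = iota b -> G z = g (h z)) ->
      \int[(set_val mu : probability (borel E') R)]_x g x =
      \int[(set_val (s (iota b)) : probability (borel E) R)]_x G x.
  set nu := s (iota b).
  have nub : msupport (set_val nu) `<=` f @^-1` [set iota b].
    by have := @fibre_mapP _ _ f _ nu; rewrite sK.
  have [[a [z [a0 a1 nuE]]] _] := set_valP nu.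
  have [P PE] := exists_finitely_supported (fun i => h (z i) : borel E') a0 a1.
  have Pb : msupport (P : measures R E') `<=` f' @^-1` [set b].
    apply: (msupport_sub a0 PE) => // i ai; apply: fh.
    exact: nub (msupport_atom a0 nuE ai).
  have PP : @fibre_measures R _ _ f' n.+1 (P : measures R E').
    by split; [exists a, (fun i => h (z i))|exists b].
  exists (SigSub (mem_set PP)); split => // g G [cg _] [cG _] gG.
  rewrite (integral_finitely_supported a0 PE cg).
  rewrite (integral_finitely_supported a0 nuE cG).
  apply: eq_bigr => i _; have := a0 i.
  (* Atoms of weight zero may lie outside the fibre; their terms vanish. *)
  rewrite le_eqVlt => /orP[/eqP <-|ai]; first by rewrite !mul0r.
  by rewrite gG//; exact: nub (msupport_atom a0 nuE ai).
have [s' s'P] := choice ex; exists s'; split; last first.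
  by move=> b; apply: fibre_map_eq; have [] := s'P b.
(* The subspace topology and the weak topology are both initial, which leaves continuity of the
   integral of each [g]. *)
apply: continuous_comp_initial; apply: continuous_comp_initial.
apply: continuous_ptws => g.
have [G bG gG] := ext _ (set_valP g).
pose G' : @bounded_continuous R E := SigSub (mem_set bG).
have -> : (fun b => ((@integrate R E') \o (set_val \o s')) b g) =
    (fun x => x G') \o (@integrate R E) \o set_val \o s \o iota.
  apply/funext => b; have [_ /(_ _ _ (set_valP g) bG)] := s'P b.
  by move=> /(_ (fun z => gG z b)).
pose v (nu : @fibre_measures R _ _ f n.+1) : measures R E := set_val nu.
pose J (nu : measures R E) : {ptws @bounded_continuous R E -> R} := integrate nu.
have cv : continuous v by exact: initial_continuous.
have cJ : continuous J by exact: initial_continuous.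
have cJs : continuous (J \o (v \o s)).
  move=> b; apply: continuous_comp; last exact: cJ.
  by apply: continuous_comp; [exact: cs|exact: cv].
move=> b; apply: (continuous_comp (f := iota)
  (g := (fun x : {ptws @bounded_continuous R E -> R} => x G') \o (J \o (v \o s)))).
  exact: ci.
by apply: continuous_comp; [exact: cJs|exact: continuous_ptws_eval].
Qed.

Lemma le_dsecat (E B E' B' : ptopologicalType) (f : E -> B) (f' : E' -> B') :
  (forall n, has_section R f n.+1 -> has_section R f' n.+1) ->
  (dsecat R f' <= dsecat R f)%E.
Proof.
move=> ff'; apply: ereal_inf_le_tmp; apply: image_subset => n /=.
exact: ff'.
Qed.

End sectional_category.

(** * The two inequalities *)

Section orbit_space.
Local Open Scope quotient_scope.
Variables (E B : ptopologicalType) (q : E -> B) (m : nat).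

Let pi (y : power E m) : orbit_space q m := \pi_(orbit_space q m) y.

Lemma continuous_orbit_pi : continuous pi.
Proof. exact: (@pi_continuous (power E m) (orbit_space q m)). Qed.

Lemma continuous_orbit_space (Z : topologicalType) (f : orbit_space q m -> Z) :
  continuous (f \o pi) -> continuous f.
Proof.
exact: (proj2 (@quotient_continuous (power E m) (orbit_space q m) Z f)).
Qed.

Lemma orbit_repr_pi (y : power E m) :
  exists2 g, deck_transformation q g & repr (pi y) = g \o y.
Proof.
have : diagonal_equiv q m y (repr (pi y)).
  by apply/eqmodP; rewrite reprK.
by move=> /asboolP[g qg ->]; exists g.
Qed.

Lemma orbit_map_pi (y : power E m) : orbit_map (pi y) = (fun i => q (y i)).
Proof.
have [g [qg _] gy] := orbit_repr_pi y; rewrite /orbit_map gy.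
by apply/funext => i /=; rewrite -[in RHS]qg.
Qed.

Lemma continuous_orbit_map : continuous q -> continuous (@orbit_map _ _ q m).
Proof.
move=> cq; apply: continuous_orbit_space; apply: continuous_power => i.
have -> : (fun y => (@orbit_map _ _ q m \o pi) y i) =
    q \o (fun y : power E m => y i).
  by apply/funext => y /=; rewrite orbit_map_pi.
exact: (comp_continuous (@continuous_power_proj E m i) cq).
Qed.

End orbit_space.

Lemma deck_transformation_id (E B : topologicalType) (q : E -> B) :
  deck_transformation q id.
Proof. by split=> //; exists id; split=> // x; exact: cvg_id. Qed.

Lemma deck_transformation_comp (E B : topologicalType) (q : E -> B) g h :
  deck_transformation q g -> deck_transformation q h ->
  deck_transformation q (g \o h).
Proof.
move=> [qg [g' [cg cg' gK g'K]]] [qh [h' [ch ch' hK h'K]]].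
split; first by rewrite compA qg.
exists (h' \o g'); split.
- exact: comp_continuous.
- exact: comp_continuous.
- by move=> x /=; rewrite gK hK.
- by move=> x /=; rewrite h'K g'K.
Qed.

(** * Comparison of the orbit space with universal coverings of powers *)

Section comparison.
Variables (R : realType) (X : ptopologicalType) (q : universal_covering R X).
Hypotheses (cwX : CW_complex R X) (connX : connected [set: X]).

Let E : ptopologicalType := total_space q.
Let qcov : covering_map q := projection_covering q.
Let scE : simply_connected R E := total_space_simply_connected q.
Let lX : locally_path_connected R X := CW_locally_path_connected cwX.
Let lE : locally_path_connected R E := locally_path_connected_covering qcov lX.
Let cq : continuous q := covering_continuous qcov.

Let closed_point (x : X) : closed [set x].
Proof. by have [hX _] := cwX; exact/accessible_closed_set1/hausdorff_accessible. Qed.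

Let covering_closed_fibre n (F : topologicalType) (p : F -> power X n) :
  continuous p -> forall b, closed (p @^-1` [set b]).
Proof.
move=> cp b.
exact: (closed_preimage cp (@closed_power_point X n closed_point b)).
Qed.

Lemma dTC_diag_le_dcat1 m (q2 : universal_covering R (power X m)) :
  (dTC_diag m q <= dcat1 q2)%E.
Proof.
have q2cov := projection_covering q2; have cq2 := covering_continuous q2cov.
have lE2 := locally_path_connected_covering q2cov
  (locally_path_connected_power (m := m) lX).
have exF i : exists F : total_space q2 -> E, continuous F /\
    forall e, q (F e) = q2 e i.
  (* The lifting theorem needs a starting value over the [i]-th coordinate of the image of the base
     point. *)
  have [e0 qe0] := covering_surjective qcov point connX (q2 point i).
  have cqi : continuous (fun e => q2 e i).
    exact: continuous_power_coord.
  have [F [cF qF _]] := lifting qcov (total_space_simply_connected q2) lE2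
    cqi qe0.
  by exists F.
have [F FP] := choice exF.
pose Fm e : power E m := fun i => F i e.
have cFm : continuous Fm by apply: continuous_power => i; have [] := FP i.
pose h e : orbit_space q m := (\pi_(orbit_space q m) (Fm e))%qT.
have ch : continuous h.
  exact: (comp_continuous cFm (@continuous_orbit_pi E X q m)).
apply: le_dsecat => n; apply: (has_section_transfer (iota := id) (h := h)).
- by move=> x; exact: cvg_id.
- by apply: covering_closed_fibre; exact: continuous_orbit_map.
- move=> z b <-; rewrite orbit_map_pi; apply/funext => i.
  by have [_ ->] := FP i.
(* Here [h] is continuous, so test functions simply pull back. *)
- move=> g [cg [M gM]]; exists (g \o h) => //; split; last by exists M => z; exact: gM.
  exact: comp_continuous.
Qed.

Section lower_bound.
Variables (k : nat) (q1 : universal_covering R (power X k)).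
Variables (U : set X) (V : set E) (s : X -> E) (phi : X -> R).
Let x0 : X := q point.
Hypotheses (oV : open V) (sV : forall v, V v -> U (q v) /\ s (q v) = v).
Hypotheses (cphi : continuous phi) (phi1 : forall x, `|phi x| <= 1)
  (phi_out : forall x, ~ U x -> phi x = 0) (phi_x0 : phi x0 = 1).

Variable normalizer : E -> E -> E.
Hypotheses (normalizer_deck : forall e, deck_transformation q (normalizer e))
  (normalizer_sheet : forall e, U (q e) -> V (normalizer e e)).

(** Both images of [e] lie in [V] over the same point, where [q] is injective, and deck
    transformations agreeing at a point coincide. *)
Let normalizerE g e : deck_transformation q g -> V (g e) -> normalizer e = g.
Proof.
move=> dg Vg; have [_ qg] := deck_transformationP dg.
have [_ qn] := deck_transformationP (normalizer_deck e).
have [Ue sg] := sV Vg; rewrite qg in Ue sg.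
have [_ sn] := sV (normalizer_sheet Ue); rewrite qn in sn.
apply: (deck_transformation_unique qcov scE (normalizer_deck e) dg (e := e)).
by rewrite -sg -sn.
Qed.

(* An orbit lying over [U * X^k] has a unique representative whose coordinate
   [ord0] is in [V], so the part of the orbit space over [U * X^k] is
   [V * E^k]; this is the projection to [E^k]. *)
Let tail (y : power E k.+1) : power E k :=
  fun j => normalizer (y ord0) (y (lift ord0 j)).

(** Over [U], the transformation normalizing [g (y ord0)], composed with [g], brings [y ord0] into
    [V], so it is the normalizer of [y ord0]. *)
Let tail_deck g y : deck_transformation q g -> U (q (y ord0)) ->
  tail (g \o y) = tail y.
Proof.
move=> dg Uy; apply/funext => j; rewrite /tail /=.
have dgy := deck_transformation_comp (normalizer_deck (g (y ord0))) dg.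
rewrite (@normalizerE _ (y ord0) dgy)//=; apply: normalizer_sheet.
by have [_ ->] := deck_transformationP dg.
Qed.

Let coordinates_q (y : power E k) : power X k := fun j => q (y j).

Let continuous_coordinates_q : continuous coordinates_q.
Proof.
apply: continuous_power => j.
exact: (comp_continuous (@continuous_power_proj E k j) cq).
Qed.

Let exists_comparison : exists L : power E k -> total_space q1,
  continuous L /\ forall y, q1 (L y) = coordinates_q y.
Proof.
have [y0 qy0] := choice (fun j => covering_surjective qcov point connX
  (q1 point j)).
have qe : q1 point = coordinates_q y0 by apply/funext => j; rewrite -qy0.
have [L [cL qL _]] := lifting (projection_covering q1)
  (@simply_connected_power E k R scE) (@locally_path_connected_power E k R lE)
  continuous_coordinates_q qe.
by exists L.
Qed.

Lemma dcat1_le_dTC_diag_sheet : (dcat1 q1 <= dTC_diag k.+1 q)%E.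
Proof.
have [L [cL qL]] := exists_comparison.
(* Off [U] the values of [tail] depend on arbitrary choices, so [h] may be discontinuous there. *)
pose h (c : orbit_space q k.+1) := L (tail (repr c : power E k.+1)).
pose iota (x : power X k) : power X k.+1 := fun i => oapp x x0 (unlift ord0 i).
have iota0 x : iota x ord0 = x0 by rewrite /iota unlift_none.
have iotaS x j : iota x (lift ord0 j) = x j by rewrite /iota liftK.
apply: le_dsecat => n; apply: (has_section_transfer (iota := iota) (h := h)).
- apply: continuous_power => i; rewrite /iota; case: (unlift ord0 i) => [j|] /=.
    exact: continuous_power_proj.
  exact: cst_continuous.
- by apply: covering_closed_fibre; exact/covering_continuous/projection_covering.
- move=> c b cb; rewrite qL; apply/funext => j.
  rewrite /coordinates_q /tail; have [_ ->] := deck_transformationP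
    (normalizer_deck (repr c ord0)).
  by rewrite -iotaS -cb.
move=> g [cg [M gM]].
(* The cutoff factor is 1 over the slice and vanishes where [h] is not controlled. *)
exists (fun c => g (h c) * phi (orbit_map c ord0)); last first.
  by move=> c b cb; rewrite cb iota0 phi_x0 mulr1.
split; last first.
  exists M => c; rewrite normrM -[leRHS]mulr1.
  by apply: ler_pM.
apply: continuous_orbit_space.
pose G (y : power E k.+1) := g (L (tail y)) * phi (q (y ord0)).
have -> : (fun c => g (h c) * phi (orbit_map c ord0)) \o
    (fun y => \pi_(orbit_space q k.+1) y)%qT = G.
  apply/funext => y; rewrite /G /= orbit_map_pi.
  have [Uy|nUy] := pselect (U (q (y ord0))); last by rewrite phi_out// !mulr0.
  have [d dd dy] := orbit_repr_pi q y.
  by rewrite /h dy tail_deck.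
have cphiq : continuous (fun y : power E k.+1 => phi (q (y ord0))).
  have c0 := comp_continuous (@continuous_power_proj E k.+1 ord0) cq.
  exact: (comp_continuous c0 cphi).
move=> y; have [Uy|nUy] := pselect (U (q (y ord0))).
  have [cd _] := deck_transformationP (normalizer_deck (y ord0)).
  (* Freezing the normalizer at [y ord0] gives a continuous function that agrees with [G] as long as
     the first coordinate stays in the translated sheet. *)
  pose G' (y' : power E k.+1) := g (L (fun j =>
    normalizer (y ord0) (y' (lift ord0 j)))) * phi (q (y' ord0)).
  have cG' : continuous G'.
    have ct : continuous (fun y' : power E k.+1 =>
        (fun j => normalizer (y ord0) (y' (lift ord0 j))) : power E k).
      apply: continuous_power => j.
      exact: (comp_continuous (@continuous_power_proj E k.+1 (lift ord0 j)) cd).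
    move=> y'; apply: cvgM; last exact: cphiq.
    exact: (comp_continuous (comp_continuous ct cL) cg).
  have nV : nbhs y [set y' : power E k.+1 | V (normalizer (y ord0) (y' ord0))].
    have nV0 : nbhs (normalizer (y ord0) (y ord0)) V.
      by apply: open_nbhs_nbhs; split => //; exact: normalizer_sheet.
    exact: (comp_continuous (@continuous_power_proj E k.+1 ord0) cd nV0).
  have GG' (y' : power E k.+1) : V (normalizer (y ord0) (y' ord0)) ->
      G y' = G' y'.
    move=> Vy'; rewrite /G /G' /tail.
    by rewrite (normalizerE (normalizer_deck (y ord0)) Vy').
  move=> W; rewrite GG'; last exact: normalizer_sheet.
  move=> /cG' nW; have nW' : nbhs y (G' @^-1` W) := nW.
  suff : nbhs y (G @^-1` W) by [].
  by apply: filterS2 nV nW' => y' /GG' /= ->.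
(* Off [U] continuity comes from the bound of [G] by [M] times the absolute value of [phi], which
   tends to 0 at [y]. *)
have Gy : G y = 0 by rewrite /G phi_out// mulr0.
have M0 : 0 <= M by exact: le_trans (normr_ge0 _) (gM point).
rewrite /continuous_at Gy; apply/cvgrPdist_lt => e e0.
(* [M] may be 0, so the division is by [M + 1]. *)
have e1 : 0 < e / (M + 1) by apply: divr_gt0 => //; lra.
have := cphiq y; rewrite /continuous_at phi_out// => /cvgrPdist_lt/(_ _ e1).
apply: filterS => y'; rewrite !sub0r !normrN /G normrM => phie.
apply: (@le_lt_trans _ _ (M * `|phi (q (y' ord0))|)).
  by apply: ler_wpM2r.
apply: (@le_lt_trans _ _ ((M + 1) * `|phi (q (y' ord0))|)).
  by apply: ler_wpM2r => //; lra.
by rewrite mulrC -ltr_pdivlMr//; lra.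
Qed.

End lower_bound.

Lemma dcat1_le_dTC_diag k (q1 : universal_covering R (power X k)) :
  (dcat1 q1 <= dTC_diag k.+1 q)%E.
Proof.
have [U [V [s [[oU Ux] [oV _] _ sV sU]]]] := covering_sheet qcov point.
have dis : ~` U `&` [set q point] = set0.
  by apply/seteqP; split=> // z [nUz zx]; apply: nUz; rewrite zx.
have [phi [cphi phi1 phi0 phix]] := CW_separation cwX (open_closedC oU)
  (@closed_point (q point)) dis.
(* Over [U], the point [s (q e)] lies in [V] and in the fibre of [e], so a deck transformation
   carries [e] to it. Elsewhere the identity is the default. *)
have exN e : exists g, deck_transformation q g /\ (U (q e) -> V (g e)).
  have [Ue|nUe] := pselect (U (q e)); last first.
    by exists id; split=> //; exact: deck_transformation_id.
  have [Vs qs] := sU _ Ue.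
  have [g dg ge] := deck_transformation_transitive qcov scE lE (esym qs).
  by exists g; rewrite ge.
have [N NP] := choice exN.
apply: (dcat1_le_dTC_diag_sheet q1 oV sV cphi phi1 phi0 _ (normalizer := N)).
- exact: phix.
- by move=> e; have [] := NP e.
- by move=> e; have [] := NP e.
Qed.

End comparison.

Theorem proposition7p3 (R : realType) (X : ptopologicalType) (m : nat)
    (q : universal_covering R X)
    (q1 : universal_covering R (power X m.-1))
    (q2 : universal_covering R (power X m)) :
  CW_complex R X -> connected [set: X]%classic -> (2 <= m)%N ->
  (dcat1 q1 <= dTC_diag m q)%E /\ (dTC_diag m q <= dcat1 q2)%E.
Proof.
move=> cwX connX m2; split; last exact: dTC_diag_le_dcat1.
by case: m q1 q2 m2 => // k q1 _ _; exact: dcat1_le_dTC_diag.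
Qed.
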